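(* The number of locally-valid MV assignments of any $m\times n$ modified Miura-ori crease pattern is equal to the number of locally-valid MV assignments of an $m\times n$ standard Miura-ori crease pattern.
   Context: **Modified Miura-ori.** An $m\times n$ (modified) Miura-ori crease pattern has $m$ rows and $n$ columns of faces. It is formed by $m-1$ straight horizontal crease lines crossed by $n-1$ vertical zig-zag columns of creases. In coordinates: the horizontal creases lie on the lines $y=i$, $1\le i\le m-1$, of the paper $P$ with $0\le y\le m$; for $1\le j\le n-1$ the $j$-th zig-zag is the polyline through the points $p_{i,j}=(x_j+\epsilon_j(-1)^i\delta,\; i)$, $i=0,\dots,m$, where $\delta>0$, $\epsilon_j\in\{1,-1\}$, and $x_1<\cdots<x_{n-1}$ are spaced so that the zig-zags are pairwise disjoint and interior to the left and right edges of $P$. The interior vertices are the $p_{i,j}$ with $1\le i\le m-1$, $1\le j\le n-1$, each of degree 4; the creases are the segments into which the horizontal lines and zig-zags are cut by these vertices (those at the ends terminate on the boundary of $P$). The standard Miura-ori is the case where all $\epsilon_j$ are equal (its faces away from the left and right edges are congruent-angled parallelograms); a modified Miura-ori is obtained from the standard one by reflecting some of the zig-zag columns from left to right, i.e. by an arbitrary choice of signs $\epsilon_j$. **MV assignments.** A MV assignment is a function $\mu$ from the set of creases to $\{1,-1\}$ (mountain $=1$, valley $=-1$). It is locally-valid if at each interior vertex the creases at that vertex fold flat without self-intersection. Every interior vertex here is a bird's foot: two consecutive equal acute sector angles bordered by three creases (the toes), and two equal obtuse sector angles, meeting at the fourth crease (the heel, collinear with the middle toe). Such a vertex is validly assigned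 if and only if $\mu(\text{heel})$ equals the sum of the values of $\mu$ on the three toes (known characterization). *)

(* Defs.v *)
From mathcomp Require Import all_boot all_order all_algebra all_fingroup.
From mathcomp Require Import all_classical all_reals all_analysis.

Set Implicit Arguments.
Unset Strict Implicit.
Unset Printing Implicit Defensive.
Import Order.TTheory GRing.Theory Num.Theory.
Local Open Scope classical_set_scope.
Local Open Scope ring_scope.

(** The two-element type {1, -1}, a subtype of [int]. *)
Notation pm1 := (seq_sub [:: 1 : int; -1 : int]).

(** ** Flat folding of a degree-4 vertex

    The creases at the vertex are numbered 0, 1, 2, 3 counterclockwise, and
    sector [k] lies between crease [k] and crease [ordS k].  Unfolded, the top
    side of the paper faces the viewer; folded, the even sectors still face up
    and the odd sectors face down. *)

Section Vertex.
Variable R : realType.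
Implicit Types (u : 'I_4 -> R * R) (theta : 'I_4 -> R) (mu : 'I_4 -> pm1).

Definition dot (a b : R * R) : R := a.1 * b.1 + a.2 * b.2.

(** In [0, pi]: the sectors must be smaller than a half-plane. *)
Definition angle (a b : R * R) : R :=
  acos (dot a b / (Num.sqrt (dot a a) * Num.sqrt (dot b b))).

Definition sector_angle u (k : 'I_4) : R := angle (u k) (u (ordS k)).

(** A small circle around the vertex, cut open at crease 0, is mapped by the
    folding to the line, reversing direction at each crease.  This is the image
    of crease [k]; sector [k] is mapped to the interval between the images of
    its two creases. *)
Definition fold_pos theta (k : 'I_4) : R :=
  \sum_(l < 4 | (l < k)%N) (-1) ^+ l * theta l.

Definition fold_closes theta : bool := \sum_(l < 4) (-1) ^+ l * theta l == 0.

Definition in_sector_image theta (d : 'I_4) (x : R) : bool :=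
  Num.min (fold_pos theta d) (fold_pos theta (ordS d)) < x
  < Num.max (fold_pos theta d) (fold_pos theta (ordS d)).

(** A stacking order of the sectors: [s d] is the height of sector [d]. *)
Implicit Type s : 'S_4.

Definition between s (a d b : 'I_4) : bool :=
  (s a < s d < s b)%N || (s b < s d < s a)%N.

(** Crease [k] joins sectors [ord_pred k] and [k], one of which faces up (the
    even one) and the other down.  At a mountain the bottom sides touch, so the
    even sector is on top; at a valley the top sides touch. *)
Definition respects_mv mu s : bool :=
  [forall k : 'I_4, (val (mu k) == 1) ==
     (if odd k then (s k < s (ord_pred k))%N else (s (ord_pred k) < s k)%N)].

(** No sector passes through a crease. *)
Definition no_sector_crossing theta s : bool :=
  [forall k : 'I_4, forall d : 'I_4,
     in_sector_image theta d (fold_pos theta k) ==> ~~ between s (ord_pred k) d k].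

(** Two creases folded to the same place, with their sectors on the same side,
    do not interlock.  Both sectors at crease [k] are mapped to the right of its
    image if [k] is even and to the left if [k] is odd. *)
Definition no_crease_crossing theta s : bool :=
  [forall k : 'I_4, forall l : 'I_4,
     [&& k != l, odd k == odd l & fold_pos theta k == fold_pos theta l] ==>
     (between s (ord_pred k) (ord_pred l) k == between s (ord_pred k) l k)].

Definition folds_flat u mu : bool :=
  let theta := sector_angle u in
  fold_closes theta &&
  [exists s : 'S_4, [&& respects_mv mu s, no_sector_crossing theta s
                      & no_crease_crossing theta s]].

End Vertex.

(** ** Modified Miura-ori *)

(** The paper is [[xleft, xright] x [0, m]].  Only [xs j] and [eps j] with
    [1 <= j <= n - 1] are meaningful. *)
Record miura_data (R : realType) := MiuraData {
  xleft : R;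
  xright : R;
  delta : R;
  xs : nat -> R;
  eps : nat -> pm1
}.

Section Miura.
Variables (R : realType) (m n : nat).
Implicit Type P : miura_data R.

(** The point p_(i,j). *)
Definition zigzag_point P (i j : nat) : R * R :=
  (xs P j + (val (eps P j))%:~R * (-1) ^+ i * delta P, i%:R).

Definition zigzag P (j : nat) : set (R * R) :=
  [set q | exists2 i : nat, (i < m)%N & exists2 t : R, 0 <= t <= 1 &
     q = ((1 - t) * (zigzag_point P i j).1 + t * (zigzag_point P i.+1 j).1,
          (1 - t) * (zigzag_point P i j).2 + t * (zigzag_point P i.+1 j).2)].

Definition modified_miura P : Prop :=
  [/\ xleft P < xright P,
      0 < delta P,
      forall j k : nat, (0 < j)%N -> (j < k)%N -> (k < n)%N -> xs P j < xs P k,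
      forall j k : nat, (0 < j < n)%N -> (0 < k < n)%N -> j <> k ->
        zigzag P j `&` zigzag P k = set0
    & forall (j : nat) (q : R * R), (0 < j < n)%N -> zigzag P j q ->
        xleft P < q.1 < xright P].

Definition standard_miura P : Prop :=
  modified_miura P /\
  forall j k : nat, (0 < j < n)%N -> (0 < k < n)%N -> eps P j = eps P k.

(** The endpoints of creases, indexed by [0 <= i <= m] and [0 <= j <= n]: the
    columns [j = 0] and [j = n] are on the left and right edges of the paper. *)
Definition node_pos P (v : nat * nat) : R * R :=
  if v.2 == 0%N then (xleft P, v.1%:R)
  else if v.2 == n then (xright P, v.1%:R)
  else zigzag_point P v.1 v.2.

(** [inl (i, j)] is the segment of the horizontal line y = i+1 from node
    (i+1, j) to node (i+1, j+1); [inr (i, j)] is the segment of the zig-zag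
    j+1 from node (i, j+1) to node (i+1, j+1). *)
Definition crease : finType := (('I_m.-1 * 'I_n) + ('I_m * 'I_n.-1))%type.

Definition crease_ends (c : crease) : (nat * nat) * (nat * nat) :=
  match c with
  | inl (i, j) => ((i.+1, nat_of_ord j), (i.+1, j.+1))
  | inr (i, j) => ((nat_of_ord i, j.+1), (i.+1, j.+1))
  end.

(** [(i, j)] stands for the interior vertex p_(i+1,j+1). *)
Definition vertex : finType := ('I_m.-1 * 'I_n.-1)%type.

Definition vertex_node (v : vertex) : nat * nat := (v.1.+1, v.2.+1).

Fact succ_pred_ltn (p : nat) (i : 'I_p.-1) : (i.+1 < p)%N.
Proof. by case: i => i /=; case: p. Qed.

Definition ord_lo (p : nat) (i : 'I_p.-1) : 'I_p := widen_ord (leq_pred p) i.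
Definition ord_hi (p : nat) (i : 'I_p.-1) : 'I_p := Ordinal (succ_pred_ltn i).

(** Counterclockwise: right, up, left, down. *)
Definition crease_at (v : vertex) (k : 'I_4) : crease :=
  match nat_of_ord k with
  | 0 => inl (v.1, ord_hi v.2)
  | 1 => inr (ord_hi v.1, v.2)
  | 2 => inl (v.1, ord_lo v.2)
  | _ => inr (ord_lo v.1, v.2)
  end.

(** The vector from vertex [v] to the other end of an incident crease [c]. *)
Definition crease_dir P (v : vertex) (c : crease) : R * R :=
  let e := crease_ends c in
  let w := if e.1 == vertex_node v then e.2 else e.1 in
  ((node_pos P w).1 - (node_pos P (vertex_node v)).1,
   (node_pos P w).2 - (node_pos P (vertex_node v)).2).

(** Mountain is 1 and valley is -1. *)
Definition mv_assignment : finType := {ffun crease -> pm1}.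

Definition locally_valid P (mu : mv_assignment) : bool :=
  [forall v : vertex,
     folds_flat (fun k => crease_dir P v (crease_at v k))
                (fun k => mu (crease_at v k))].

Definition num_locally_valid P : nat :=
  #|[set mu : mv_assignment | locally_valid P mu]%SET|.

End Miura.

(* Main.v *)
(** At a vertex of a zig-zag pointing left or right, the two vertical creases
    either differ, and then the two horizontal ones agree, or are equal, and
    then the heel agrees with them and the horizontal toe does not.  Reflecting
    a column exchanges heel and horizontal toe, so it amounts to changing the
    sign of all vertical creases of that column; every vertical crease belongs
    to a single column, so this is a bijection between the assignments. *)

Require Import Defs.
From mathcomp Require Import all_boot all_order all_algebra.
From mathcomp Require Import all_classical all_reals all_analysis.
From mathcomp Require Import zify ring lra.
Import fingroup.perm.
Import Order.TTheory GRing.Theory Num.Theory.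
Local Open Scope ring_scope.
Set Implicit Arguments.
Unset Strict Implicit.
Unset Printing Implicit Defensive.

(** * Finite search over stacking orders *)

(** Replaces a quantifier over ['S_n], which does not compute, by a search through an explicit list
    that [vm_compute] can evaluate. *)
Lemma exists_perm_permutations n (Q : pred (seq nat)) :
  [exists s : 'S_n, Q [seq val (s i) | i <- enum 'I_n]] =
  has Q (permutations (iota 0 n)).
Proof.
apply/existsP/hasP => [[s Qs]|[t]].
  exists [seq val (s i) | i <- enum 'I_n] => //.
  rewrite mem_permutations -val_enum_ord (map_comp val s) perm_map //.
  apply: uniq_perm; rewrite ?enum_uniq ?(map_inj_uniq perm_inj) ?enum_uniq //.
  move=> x; rewrite mem_enum; apply/mapP; exists (perm_inv s x) => //.
    by rewrite mem_enum.
  by rewrite permKV.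
rewrite mem_permutations => tP Qt.
have szt : size t = n by rewrite (perm_size tP) size_iota.
have ltn k : (k < n)%N -> (nth 0 t k < n)%N.
  move=> kn; have : nth 0 t k \in t by rewrite mem_nth ?szt.
  by rewrite (perm_mem tP) mem_iota.
pose f (k : 'I_n) := Ordinal (ltn _ (ltn_ord k)).
have f_inj : injective f.
  move=> j k /(congr1 val) /= /eqP.
  by rewrite nth_uniq ?szt ?(perm_uniq tP) ?iota_uniq // => /eqP /val_inj.
exists (perm f_inj); congr (Q _) : Qt.
apply: (@eq_from_nth _ 0); first by rewrite size_map size_enum_ord.
move=> k; rewrite szt => kn.
by rewrite (nth_map (Ordinal kn)) ?size_enum_ord // permE /= nth_enum_ord.
Qed.

Local Notation c0 := (@Ordinal 4 0 isT).
Local Notation c1 := (@Ordinal 4 1 isT).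
Local Notation c2 := (@Ordinal 4 2 isT).
Local Notation c3 := (@Ordinal 4 3 isT).

Lemma forall_ord4 (F : pred 'I_4) :
  [forall k, F k] = [&& F c0, F c1, F c2 & F c3].
Proof.
apply/forallP/and4P => [//|[F0 F1 F2 F3] [[|[|[|[|k]]]] ltk4]] //.
all: by rewrite (bool_irrelevance ltk4 isT).
Qed.

Lemma ordS4 :
  (ordS c0 = c1) * (ordS c1 = c2) * (ordS c2 = c3) * (ordS c3 = c0).
Proof. by do !split; apply: val_inj. Qed.

Lemma ord_pred4 : (ord_pred c0 = c3) * (ord_pred c1 = c0) *
  (ord_pred c2 = c1) * (ord_pred c3 = c2).
Proof. by do !split; apply: val_inj. Qed.

Lemma enum_ord4 : enum 'I_4 = [:: c0; c1; c2; c3].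
Proof. by apply: (inj_map val_inj); rewrite val_enum_ord. Qed.

(** Expresses a sign through the boolean that [respects_mv] tests, so that sums of signs become
    boolean data. *)
Lemma pm1_cases (x : pm1) : val x = if val x == 1 then 1 else -1.
Proof. by case: x => x /=; rewrite !inE => /orP[]/eqP->. Qed.

(** * Flat folding of a bird's foot *)

Section BirdFoot.
Variable R : realType.
Implicit Types (u : 'I_4 -> R * R) (theta : 'I_4 -> R) (mu : 'I_4 -> pm1).

Lemma fold_pos4 theta :
  (fold_pos theta c0 = 0) * (fold_pos theta c1 = theta c0) *
  (fold_pos theta c2 = theta c0 - theta c1) *
  (fold_pos theta c3 = theta c0 - theta c1 + theta c2).
Proof.
have l1 : lift ord0 ord0 = c1 by apply: val_inj.
have l2 : lift ord0 (lift ord0 ord0) = c2 by apply: val_inj.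
have l0 : ord0 = c0 by apply: val_inj.
by rewrite /fold_pos; do !split; rewrite big_mkcond !big_ord_recl big_ord0 /=;
  rewrite ?l2 ?l1 ?l0 /bump /=; ring.
Qed.

Lemma fold_closes4 theta : fold_closes theta =
  (theta c0 - theta c1 + theta c2 - theta c3 == 0).
Proof.
have l1 : lift ord0 ord0 = c1 by apply: val_inj.
have l2 : lift ord0 (lift ord0 ord0) = c2 by apply: val_inj.
have l3 : lift ord0 (lift ord0 (lift ord0 ord0)) = c3 by apply: val_inj.
have l0 : ord0 = c0 by apply: val_inj.
rewrite /fold_closes !big_ord_recl !big_ord0 /= ?l3 ?l2 ?l1 ?l0 /bump /=.
by congr (_ == _); ring.
Qed.

(** Sectors 3 and 0 meet at crease 0. If they are acute, crease 0 is the middle toe and crease 2 the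
    heel; if obtuse, the roles are exchanged. Excluding a right angle keeps the images of creases 0
    and 2 apart. *)
Lemma folds_flat_bird_foot u mu (alpha : R) :
    0 < alpha < pi -> alpha != pi / 2 ->
    sector_angle u c0 = alpha -> sector_angle u c1 = pi - alpha ->
    sector_angle u c2 = pi - alpha -> sector_angle u c3 = alpha ->
  folds_flat u mu =
  if alpha < pi / 2 then val (mu c2) == val (mu c0) + val (mu c1) + val (mu c3)
  else val (mu c0) == val (mu c1) + val (mu c2) + val (mu c3).
Proof.
move=> /andP[alpha_gt0 alpha_ltpi] alpha_neq u0 u1 u2 u3.
rewrite /folds_flat fold_closes4 u0 u1 u2 u3.
have -> : alpha - (pi - alpha) + (pi - alpha) - alpha = 0 by ring.
rewrite eqxx /=.
set acute := alpha < pi / 2.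
pose b k := val (mu k) == 1.
pose bt (h : seq nat) a d e := (nth 0 h a < nth 0 h d < nth 0 h e)%N ||
  (nth 0 h e < nth 0 h d < nth 0 h a)%N.
(* The foldability conditions on the list [h] of sector heights: the creases
   fold to [0], [alpha], [2 * alpha - pi], [alpha], so the only inequality that
   matters is whether [alpha] is acute ([o]), which leaves a finite check. *)
pose Q (b0 b1 b2 b3 o : bool) (h : seq nat) :=
  [&& b0 == (nth 0 h 3 < nth 0 h 0)%N, b1 == (nth 0 h 1 < nth 0 h 0)%N,
      b2 == (nth 0 h 1 < nth 0 h 2)%N, b3 == (nth 0 h 3 < nth 0 h 2)%N,
      (if o then ~~ bt h 3 1 0 && ~~ bt h 3 2 0
       else ~~ bt h 1 0 2 && ~~ bt h 1 3 2),
      bt h 0 2 1 == bt h 0 3 1 & bt h 2 0 3 == bt h 2 1 3]%N.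
transitivity [exists s : 'S_4, Q (b c0) (b c1) (b c2) (b c3) acute
                                [seq val (s i) | i <- enum 'I_4]]; last first.
  rewrite exists_perm_permutations.
  rewrite (pm1_cases (mu c0)) (pm1_cases (mu c1)) (pm1_cases (mu c2)).
  rewrite (pm1_cases (mu c3)) -!/(b _).
  (* Thirty-two cases, each a search through 24 orders. *)
  by case: (b c0) (b c1) (b c2) (b c3) acute => [] [] [] [] []; vm_compute.
apply: eq_existsb => s.
set beta := 2 * alpha - pi.
have pE : (fold_pos (sector_angle u) c0 = 0) *
  (fold_pos (sector_angle u) c1 = alpha) *
  (fold_pos (sector_angle u) c2 = beta) *
  (fold_pos (sector_angle u) c3 = alpha).
  by rewrite !fold_pos4 u0 u1 u2 /beta; do !split; ring.
(* [beta < alpha] because [alpha < pi]; the sign of [beta], the image of crease 2, is the only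
   comparison left open. *)
have cmp : ((0 < alpha) = true) * ((alpha < 0) = false) *
  ((beta < alpha) = true) * ((alpha < beta) = false) *
  ((beta < 0) = acute) * ((0 < beta) = ~~ acute) *
  ((0 == beta) = false) * ((beta == 0) = false).
  have beta_neq0 : (beta == 0) = false.
    apply/negP => /eqP e; move/eqP: alpha_neq; apply.
    by rewrite /beta in e; lra.
  have beta_lt0 : (beta < 0) = acute.
    by apply/idP/idP; rewrite /acute /beta; lra.
  rewrite (eq_sym 0) beta_neq0 beta_lt0 -beta_lt0 -leNgt le_eqVlt (eq_sym 0).
  rewrite beta_neq0 /= alpha_gt0 (lt_gtF alpha_gt0).
  have bLa : beta < alpha by rewrite /beta; lra.
  by rewrite bLa (lt_gtF bLa).
rewrite /respects_mv /no_sector_crossing /no_crease_crossing /in_sector_image.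
rewrite !forall_ord4 !ordS4 !ord_pred4 !pE !gt_min !lt_max !cmp !ltxx !eqxx.
rewrite enum_ord4 /Q /bt /between /b /=.
by move: acute {cmp} => [] /=; rewrite ?andbT -?andbA.
Qed.

Lemma angleC (a b : R * R) : angle a b = angle b a.
Proof.
by rewrite /angle /dot (mulrC (Num.sqrt _)) (mulrC a.1) (mulrC a.2).
Qed.

Lemma angle_horizontal (p : R) (v : R * R) : p != 0 ->
  angle (p, 0) v = acos (Num.sg p * (v.1 / Num.sqrt (dot v v))).
Proof.
move=> p_neq0; rewrite /angle /dot /= !mul0r !addr0 -expr2 sqrtr_sqr.
by rewrite {1}(numEsg p) invfM mulrACA mulfK ?normr_eq0 ?mulrA.
Qed.

Lemma folds_flat_zigzag_vertex u mu (p q a : R) :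
    0 < p -> 0 < q -> a != 0 ->
    u c0 = (p, 0) -> u c1 = (a, 1) -> u c2 = (- q, 0) -> u c3 = (a, -1) ->
  folds_flat u mu =
  if 0 < a then val (mu c2) == val (mu c0) + val (mu c1) + val (mu c3)
  else val (mu c0) == val (mu c1) + val (mu c2) + val (mu c3).
Proof.
move=> p_gt0 q_gt0 a_neq0 u0 u1 u2 u3.
pose r := Num.sqrt (a * a + 1).
have r_gt0 : 0 < r by rewrite sqrtr_gt0; nra.
have rr : r * r = a * a + 1 by rewrite -expr2 sqr_sqrtr //; nra.
(* The cosine of the angle between the right crease and either zig-zag crease; these two are mirror
   images in the horizontal line. *)
pose h := a / r.
have h_bnd : -1 < h < 1.
  by rewrite /h ltr_pdivlMr // ltr_pdivrMr //; apply/andP; split; nra.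
have [h_gtN1 h_lt1] := andP h_bnd.
have h_itv : -1 <= h <= 1 by rewrite !ltW.
have right e : e * e = 1 -> angle (p, 0) (a, e) = acos h.
  move=> ee; rewrite angle_horizontal ?gt_eqF // gtr0_sg // mul1r.
  by rewrite /dot /= ee.
have left e : e * e = 1 -> angle (- q, 0) (a, e) = pi - acos h.
  move=> ee; rewrite angle_horizontal ?lt_eqF ?oppr_lt0 //.
  by rewrite ltr0_sg ?oppr_lt0 // mulN1r /dot /= ee acosN.
have acute : (acos h < pi / 2) = (0 < a).
  rewrite -ltr_cos ?in_itv /= ?acos_ge0 ?acos_lepi //; last first.
    by have := pi_gt0 R; lra.
  by rewrite cos_pihalf acosK ?in_itv // pmulr_lgt0 ?invr_gt0.
rewrite (@folds_flat_bird_foot u mu (acos h)) ?acute //.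
- by rewrite acos_gt0 ?acos_ltpi // ?h_gtN1 ?h_lt1 ltW.
- apply/eqP => /(congr1 cos); rewrite cos_pihalf acosK ?in_itv // => /eqP.
  by rewrite mulf_eq0 invr_eq0 (negbTE a_neq0) gt_eqF.
- by rewrite /sector_angle ordS4 u0 u1 right ?mulr1.
- by rewrite /sector_angle ordS4 u1 u2 angleC left ?mulr1.
- by rewrite /sector_angle ordS4 u2 u3 left // mulrNN mulr1.
- by rewrite /sector_angle ordS4 u3 u0 angleC right // mulrNN mulr1.
Qed.

End BirdFoot.

(** * From coordinates to signs *)

Section Miura.
Variables (R : realType) (m n : nat).
Implicit Types (P : miura_data R) (mu : mv_assignment m n).

Lemma zigzag_zigzag_point P i j :
  (i < m)%N -> zigzag m P j (zigzag_point P i j).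
Proof.
move=> im; exists i => //; exists 0; first by rewrite lexx ler01.
by rewrite subr0 !mul1r !mul0r !addr0.
Qed.

(* At the height halfway between two horizontal creases the zig-zags are at
   [xs P j < xs P k], so out of order vertices would force an intersection. *)
Lemma zigzag_point_lt P i j k : modified_miura m n P ->
    (i < m)%N -> (0 < j)%N -> (j < k)%N -> (k < n)%N ->
  (zigzag_point P i j).1 < (zigzag_point P i k).1.
Proof.
move=> [_ _ xs_lt disj _] im j_gt0 jk kn; rewrite ltNge; apply/negP => le_kj.
have xs_jk := xs_lt _ _ j_gt0 jk kn.
(* Zig-zag [k] minus zig-zag [j] is [D + C] at height [i] and [D - C] at height [i.+1]; [t] is the
   zero of the linear interpolation. *)
pose D := xs P k - xs P j.
pose C := ((val (eps P k))%:~R - (val (eps P j))%:~R) * (-1) ^+ i * delta P.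
have D_gt0 : 0 < D by rewrite subr_gt0.
have DC_le0 : D + C <= 0 by move: le_kj; rewrite /D /C /=; lra.
have C_lt0 : C < 0 by lra.
pose t := (D + C) / (2 * C).
have Ct : D + (1 - t) * C - t * C = 0 by rewrite /t; field; rewrite lt_eqF.
have t_bnd : 0 <= t <= 1 by apply/andP; split; nra.
pose pt l := ((1 - t) * (zigzag_point P i l).1 + t * (zigzag_point P i.+1 l).1,
              (1 - t) * (zigzag_point P i l).2 + t * (zigzag_point P i.+1 l).2).
have pt_jk : pt j = pt k.
  congr (_, _); apply/eqP; rewrite -subr_eq0 -oppr_eq0 -Ct /D /C /= !exprS.
  by apply/eqP; ring.
have pt_zigzag l : zigzag m P l (pt l) by exists i => //; exists t.
have : (zigzag m P j `&` zigzag m P k)%classic (pt j).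
  by split; [|rewrite pt_jk].
rewrite disj //; first by rewrite j_gt0 (ltn_trans jk).
- by rewrite (ltn_trans j_gt0).
- by move=> jk_eq; rewrite jk_eq ltnn in jk.
Qed.

(** Ensures that the horizontal creases at an interior vertex point strictly right and strictly
    left. *)
Lemma node_pos_lt P i j : modified_miura m n P ->
    (i < m)%N -> (j < n)%N ->
  (node_pos n P (i, j)).1 < (node_pos n P (i, j.+1)).1.
Proof.
move=> hP im jn; rewrite /node_pos /=; have [lr _ _ _ bnd] := hP.
rewrite (ltn_eqF jn).
have pt_bnd l : (0 < l < n)%N -> xleft P < (zigzag_point P i l).1 < xright P.
  by move=> hl; apply: bnd hl _; apply: zigzag_zigzag_point.
have [->|j_neq0] := eqVneq j 0%N; case: (eqVneq _ n) => [e|Sj_neq] //=.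
- have : (0 < 1 < n)%N by lia.
  by move=> /pt_bnd/andP[].
- have : (0 < j < n)%N by lia.
  by move=> /pt_bnd/andP[].
- by apply: (zigzag_point_lt hP); lia.
Qed.

Lemma node_pos_height P v : (node_pos n P v).2 = v.1%:R.
Proof. by rewrite /node_pos; case: ifP => // _; case: ifP. Qed.

Lemma locally_valid_miura P mu : modified_miura m n P ->
  locally_valid P mu =
  [forall v : vertex m n,
    let c k := val (mu (crease_at v k)) in
    if 0 < val (eps P v.2.+1) * (-1) ^+ v.1 then c c2 == c c0 + c c1 + c c3
    else c c0 == c c1 + c c2 + c c3].
Proof.
move=> hP; apply: eq_forallb => -[i j] /=.
have im := succ_pred_ltn i; have jn := succ_pred_ltn j.
have [_ delta_gt0 _ _ _] := hP.
pose e : R := (val (eps P j.+1))%:~R.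
have e_neq0 : e != 0.
  by rewrite /e pm1_cases; case: ifP => _ //; rewrite ?oppr_eq0 oner_eq0.
pose N k l := node_pos n P (k, l).
(* The vertex is at height [i.+1], so its zig-zag neighbours, at heights [i] and [i.+2], have the
   opposite offset; [a] is the horizontal displacement to both. *)
pose a : R := 2 * delta P * (e * (-1) ^+ i).
have a_gt0 : (0 < a) = (0 < val (eps P j.+1) * (-1) ^+ i).
  rewrite /a (pmulr_rgt0 _ (mulr_gt0 (ltr0Sn R 1) delta_gt0)) /e
     -[in LHS]signr_odd -[in RHS]signr_odd pm1_cases.
  by case: ifP => _; case: odd;
    rewrite /= ?(mulr1z, mulrN1z, mulr1, mulrN1, opprK, oppr_gt0, ltr10,
      ltrN10, ltr01).
have NE l : N l j.+1 = zigzag_point P l j.+1.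
  by rewrite /N /node_pos /= (ltn_eqF jn).
rewrite (@folds_flat_zigzag_vertex _ _ _ ((N i.+1 j.+2).1 - (N i.+1 j.+1).1)
  ((N i.+1 j.+1).1 - (N i.+1 j).1) a).
- by rewrite a_gt0.
- by rewrite subr_gt0; apply: node_pos_lt.
- by rewrite subr_gt0; apply: node_pos_lt => //; apply: ltnW.
- by rewrite !mulf_neq0 ?signr_eq0 ?pnatr_eq0 // gt_eqF.
- by rewrite /crease_dir /= eqxx !node_pos_height subrr.
- rewrite /crease_dir /= eqxx !node_pos_height -!/(N _ _) !NE /=.
  congr (_, _); last by rewrite -addn1 natrD addrC addKr.
  by rewrite !exprS /a /e; ring.
- rewrite /crease_dir /= xpair_eqE eqxx (ltn_eqF (ltnSn j)) /=.
  by rewrite !node_pos_height subrr opprB.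
- rewrite /crease_dir /= xpair_eqE (ltn_eqF (ltnSn i)) /=.
  rewrite !node_pos_height -!/(N _ _) !NE /=.
  congr (_, _); last by rewrite -addn1 natrD opprD addNKr.
  by rewrite !exprS /a /e; ring.
Qed.

(** * Reflecting columns *)

Fact pm1_opp_subproof (x : pm1) : - val x \in [:: 1 : int; -1].
Proof. by rewrite pm1_cases; case: ifP. Qed.

Definition pm1_opp (x : pm1) : pm1 := SeqSub (pm1_opp_subproof x).

Lemma pm1_oppK : involutive pm1_opp.
Proof. by move=> x; apply: val_inj; rewrite /= opprK. Qed.

Definition reflect_columns (b : pred nat) mu : mv_assignment m n :=
  [ffun c => match c with
             | inr (_, j) => if b j.+1 then pm1_opp (mu c) else mu c
             | inl _ => mu c
             end].

Lemma reflect_columnsK b : involutive (reflect_columns b).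
Proof.
move=> mu; apply/ffunP => -[c|[i j]]; rewrite !ffunE //.
by case: (b _); rewrite /= ?pm1_oppK.
Qed.

(** The equation [c2 = c0 + c1 + c3] rearranges to [c0 = - c1 + c2 - c3], so negating both vertical
    creases exchanges the two validity conditions. The row sign is common to [P] and [S], hence the
    conditions differ exactly in the columns where [eps] differs. *)
Lemma locally_valid_reflect_columns P (S : miura_data R) mu :
    modified_miura m n P -> modified_miura m n S ->
  locally_valid S (reflect_columns (fun j => eps P j != eps S j) mu) =
  locally_valid P mu.
Proof.
move=> hP hS; rewrite !locally_valid_miura //; apply: eq_forallb => -[i j] /=.
rewrite !ffunE /crease_at /= -(inj_eq val_inj) !(fun_if val) -signr_odd /=.
have E (x : pm1) : ssval x = 1 \/ ssval x = -1.
  by have := pm1_cases x; case: ifP; [left|right].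
case: (E (eps P j.+1)) (E (eps S j.+1)) => -> [] ->; case: (odd i) => /=.
all: case: (E (mu (inl (i, ord_hi j)))) => ->.
all: case: (E (mu (inl (i, ord_lo j)))) => ->.
all: case: (E (mu (inr (ord_hi i, j)))) => ->.
all: by case: (E (mu (inr (ord_lo i, j)))) => ->.
Qed.

End Miura.

Theorem theorem6 (R : realType) (m n : nat) (hm : (0 < m)%N) (hn : (0 < n)%N)
    (P S : miura_data R) (hP : modified_miura m n P) (hS : standard_miura m n S) :
  num_locally_valid m n P = num_locally_valid m n S.
Proof.
pose f := reflect_columns (m := m) (n := n) (fun j => eps P j != eps S j).
have f_inj : injective f by apply: inv_inj; apply: reflect_columnsK.
(* The preimage under [f] of the valid assignments of [S] is the set of valid assignments of [P]. *)
rewrite /num_locally_valid -[RHS](card_preimset _ f_inj).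
apply: eq_card => mu; rewrite !inE.
by rewrite locally_valid_reflect_columns //; case: hS.
Qed.
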